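(* Let $n,k,s,p$ be positive integers with $s\geq 1$ and $k,p\geq 1$. There exists an integer $n_0$ such that for all $n\geq n_0$ the following holds: if $\mathcal{H}\subseteq \binom{[n]}{k}$ satisfies $\nu(\mathcal{H})\leq s$, then $$co_p(\mathcal{H})\leq co_p(\mathcal{H}_{n,k,s}),$$ with equality if and only if $\mathcal{H}\cong \mathcal{H}_{n,k,s}$.
   Context: $[n]=\{1,\dots,n\}$ and $\binom{[n]}{k}$ is the family of all $k$-element subsets of $[n]$. For $\mathcal{H}\subseteq\binom{[n]}{k}$, a matching is a set of pairwise disjoint members of $\mathcal{H}$; the matching number $\nu(\mathcal{H})$ is the largest size of a matching in $\mathcal{H}$. For $E\subseteq[n]$, the codegree is $d_{\mathcal{H}}(E)=|\{F\in\mathcal{H}:E\subseteq F\}|$. The $\ell_p$-norm of $\mathcal{H}$ is $co_p(\mathcal{H})=\sum_{E\in\binom{[n]}{k-1}}(d_{\mathcal{H}}(E))^p$. $\mathcal{H}_{n,k,s}=\{F\in\binom{[n]}{k}: F\cap[s]\neq\emptyset\}$. $\mathcal{H}\cong\mathcal{H}'$ means the families are equal up to a permutation of $[n]$. *)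

(* Defs.v *)
From mathcomp Require Import all_boot all_fingroup.

Set Implicit Arguments.
Unset Strict Implicit.
Unset Printing Implicit Defensive.

(* The ground set [n] = {1, ..., n} is rendered by 'I_n = {0, ..., n-1}, so
   that [s] becomes the set of the i : 'I_n with i < s. *)

Definition ksubsets (n k : nat) : {set {set 'I_n}} :=
  [set F : {set 'I_n} | #|F| == k].

Definition is_matching (n : nat) (H M : {set {set 'I_n}}) : bool :=
  (M \subset H) && [forall A in M, forall B in M, (A != B) ==> [disjoint A & B]].

Definition matching_number (n : nat) (H : {set {set 'I_n}}) : nat :=
  \max_(M : {set {set 'I_n}} | is_matching H M) #|M|.

Definition codegree (n : nat) (H : {set {set 'I_n}}) (E : {set 'I_n}) : nat :=
  #|[set F in H | E \subset F]|.

(* The uniformity k is an explicit argument, since it cannot be read off from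
   an empty family. *)
Definition co_norm (n k p : nat) (H : {set {set 'I_n}}) : nat :=
  \sum_(E in ksubsets n k.-1) codegree H E ^ p.

Definition Hnks (n k s : nat) : {set {set 'I_n}} :=
  [set F in ksubsets n k | F :&: [set i : 'I_n | i < s] != set0].

Definition family_iso (n : nat) (H H' : {set {set 'I_n}}) : Prop :=
  exists sigma : {perm 'I_n},
    [set [set sigma x | x in F] | F : {set 'I_n} in H] = H'.

(* Main.v *)
(* For k = 1 the family is itself a matching.  For k = m + 2, let S be the set of
   vertices of degree more than k s n^m.  Since at most n^m edges contain two given
   vertices, any matching avoiding S extends greedily by one edge through each vertex
   of S; hence |S| <= s, and if |S| = s then every edge meets S, so H lies inside a
   star, where monotonicity of the norm settles both claims.  If |S| < s, the edges
   avoiding S meet the cover of a maximal matching among them, so there are O(n^m) of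
   them, and they add only O(n^(m + p - 1)) to the norm.  Choosing T of size s
   containing S, the star of T gains at least (n - k + 1)^p - s^p on each of the order
   of n^m sets E that meet T but not S, which is of order n^(m + p). *)
Require Import Defs.
From mathcomp Require Import all_boot all_fingroup.
From mathcomp Require Import zify ring.

(** * Stars, codegrees and monotonicity of the norm *)

Definition star {n : nat} (k : nat) (T : {set 'I_n}) : {set {set 'I_n}} :=
  [set F in ksubsets n k | F :&: T != set0].

Lemma star_sub {n} k (T : {set 'I_n}) : star k T \subset ksubsets n k.
Proof. by apply/subsetP => F; rewrite inE => /andP[]. Qed.

(** An edge containing [E] has exactly one vertex more, so counting such edges amounts to counting
    the vertices that complete [E]. *)
Lemma codegreeE {n k} (H : {set {set 'I_n}}) (E : {set 'I_n}) :
  H \subset ksubsets n k.+1 -> #|E| = k ->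
  codegree H E = #|[set v in ~: E | v |: E \in H]|.
Proof.
move=> /subsetP HK cE; rewrite /codegree.
have inj : {in [set v in ~: E | v |: E \in H] &, injective (fun v => v |: E)}.
  move=> v w; rewrite !inE => /andP[vE _] _ eq_vw.
  have := setU11 v E; rewrite eq_vw !inE (negPf vE) orbF.
  by move/eqP.
rewrite -(card_in_imset inj); apply: eq_card => F; rewrite !inE.
apply/andP/imsetP => [[FH sEF] | [v]].
  have := HK _ FH; rewrite inE => /eqP cF.
  have /cards1P[v Ev] : #|F :\: E| == 1.
    by rewrite cardsD (setIidPr sEF) cF cE subSnn.
  have defF : F = v |: E by rewrite -Ev setUC -{1}(setIidPr sEF) setID.
  exists v => //; rewrite !inE -defF FH andbT.
  by have := set11 v; rewrite -Ev inE => /andP[].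
by rewrite !inE => /andP[_ vEH] ->; rewrite vEH subsetUr.
Qed.

Lemma codegree_leq {n k} (H : {set {set 'I_n}}) (E : {set 'I_n}) :
  H \subset ksubsets n k.+1 -> #|E| = k -> codegree H E <= n - k.
Proof.
move=> HK cE; rewrite (codegreeE _ _ HK cE).
have -> : n - k = #|~: E| by have := cardsC E; rewrite card_ord; lia.
by apply/subset_leq_card/subsetP => v; rewrite !inE => /andP[].
Qed.

Lemma codegreeS {n} (H G : {set {set 'I_n}}) (E : {set 'I_n}) :
  H \subset G -> codegree H E <= codegree G E.
Proof.
move=> /subsetP HG; apply/subset_leq_card/subsetP => F; rewrite !inE.
by case/andP=> /HG-> ->.
Qed.

Lemma co_normS {n} k p (H G : {set {set 'I_n}}) :
  H \subset G -> co_norm k p H <= co_norm k p G.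
Proof.
move=> HG; apply: leq_sum => E _; case: p => // p.
by rewrite leq_exp2r // codegreeS.
Qed.

(** An edge [F] of [G] missing from [H] makes the codegree of [F :\ x] strictly smaller in [H], for
    any [x] in [F]; no other term grows. *)
Lemma co_norm_proper {n k p} (H G : {set {set 'I_n}}) :
  0 < k -> 0 < p -> G \subset ksubsets n k -> H \proper G ->
  co_norm k p H < co_norm k p G.
Proof.
move=> k_gt0 p_gt0 /subsetP GK /properP[HG [F FG FnH]].
have := GK _ FG; rewrite inE => /eqP cF.
have /card_gt0P[x xF] : 0 < #|F| by rewrite cF.
have EK : F :\ x \in ksubsets n k.-1.
  by rewrite inE -cF (cardsD1 x F) xF.
rewrite /co_norm (bigD1 _ EK) [X in _ < X](bigD1 _ EK) /= -addSn leq_add //.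
  rewrite ltn_exp2r //; apply/proper_card/properP; split.
    by apply/subsetP => F'; rewrite !inE => /andP[/(subsetP HG)-> ->].
  by exists F; rewrite !inE ?FG ?(negPf FnH) ?subsetDl.
by apply: leq_sum => E _; rewrite leq_exp2r // codegreeS.
Qed.

(** * Invariance under permutations of the ground set *)

Lemma family_iso_co_norm {n} k p (H G : {set {set 'I_n}}) :
  family_iso H G -> co_norm k p H = co_norm k p G.
Proof.
case=> sigma <-; have inj := imset_inj (@perm_inj _ sigma).
rewrite /co_norm [RHS](reindex_inj inj) /=; apply: eq_big => E.
  by rewrite !inE card_imset //; apply: perm_inj.
move=> _; congr (_ ^ _); rewrite /codegree -(card_imset _ inj).
apply: eq_card => F; rewrite !inE; apply/imsetP/andP => [[F'] | [/imsetP[F' F'H ->]]].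
  by rewrite inE => /andP[F'H sEF'] ->; rewrite imset_f // imsetS.
move=> sEF; exists F' => //; rewrite inE F'H /=.
apply/subsetP => x xE; have := subsetP sEF _ (imset_f sigma xE).
by rewrite mem_imset //; apply: perm_inj.
Qed.

Lemma perm_to_initial_segment {n} (T : {set 'I_n}) :
  exists sigma : {perm 'I_n}, forall i, (sigma i < #|T|) = (i \in T).
Proof.
(* List [T] first and its complement after it; the permutation sends each point to its position in
   this list. *)
pose l := enum T ++ enum (~: T).
have inl i : i \in l by rewrite mem_cat !mem_enum inE orbN.
have szl : size l = n by rewrite size_cat -!cardE cardsC card_ord.
have lt_l i : index i l < n by have := inl i; rewrite -index_mem szl.
have inj : injective (fun i => Ordinal (lt_l i)).
  move=> i j [] eq_ij; rewrite -(nth_index i (inl i)) eq_ij.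
  exact: nth_index.
exists (perm inj) => i; rewrite permE /= index_cat cardE mem_enum.
case: ifP => iT; first by rewrite index_mem mem_enum.
by rewrite ltnNge leq_addr.
Qed.

Lemma star_iso {n} k (T : {set 'I_n}) : family_iso (star k T) (Hnks n k #|T|).
Proof.
have [sigma sigmaT] := perm_to_initial_segment T; exists sigma.
have inj := @perm_inj _ sigma.
have meet (F : {set 'I_n}) :
    (sigma @: F :&: [set i : 'I_n | i < #|T|] != set0) = (F :&: T != set0).
  apply/set0Pn/set0Pn => [[i] | [i]].
    by rewrite inE => /andP[/imsetP[j jF ->]]; rewrite inE sigmaT => jT; exists j; rewrite inE jF.
  by rewrite inE => /andP[iF iT]; exists (sigma i); rewrite inE imset_f // inE sigmaT.
apply/setP => F; apply/imsetP/idP => [[F'] | FH].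
  by rewrite !inE => /andP[cF' mF'] ->; rewrite card_imset // cF' meet.
have defF : F = sigma @: (sigma @^-1: F).
  apply/setP => i; apply/idP/imsetP => [iF | [j]]; last by rewrite inE => ? ->.
  by exists ((sigma^-1)%g i); rewrite ?inE permKV.
exists (sigma @^-1: F) => //; move: FH.
by rewrite {1}defF !inE meet card_imset.
Qed.

(** By strict monotonicity, a subfamily of a star that attains the norm of the star is the whole
    star. *)
Lemma theorem_star {n k p} (H : {set {set 'I_n}}) (T : {set 'I_n}) :
  0 < k -> 0 < p -> H \subset star k T ->
  co_norm k p H <= co_norm k p (Hnks n k #|T|) /\
  (co_norm k p H = co_norm k p (Hnks n k #|T|) <-> family_iso H (Hnks n k #|T|)).
Proof.
move=> k_gt0 p_gt0 HT; rewrite -(family_iso_co_norm k p _ _ (star_iso k T)).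
split; first exact: co_normS.
split=> [eq_co | iso]; last first.
  by rewrite (family_iso_co_norm k p _ _ iso) (family_iso_co_norm k p _ _ (star_iso k T)).
have -> : H = star k T; last exact: star_iso.
apply/eqP/idPn => neq.
have := co_norm_proper H _ k_gt0 p_gt0 (star_sub k T).
by rewrite eq_co ltnn properEneq neq HT => /(_ isT).
Qed.

(** * Counting edges through prescribed vertices *)

Lemma card_ksubsets_supset {n k} (D : {set 'I_n}) :
  #|[set F in ksubsets n k | D \subset F]| <= n ^ (k - #|D|).
Proof.
have inj : {in [set F in ksubsets n k | D \subset F] &, injective (fun F => F :\: D)}.
  move=> F G; rewrite !inE => /andP[_ sDF] /andP[_ sDG] eqFG.
  by rewrite -(setID F D) -(setID G D) eqFG (setIidPr sDF) (setIidPr sDG).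
rewrite -(card_in_imset inj).
have le_bin : 'C(n, k - #|D|) <= n ^ (k - #|D|).
  apply: leq_trans (_ : _ <= n ^_ (k - #|D|)) _.
    by rewrite -bin_ffact leq_pmulr // fact_gt0.
  elim: (k - #|D|) => // j IHj; rewrite ffactnSr expnSr.
  by rewrite leq_mul // leq_subr.
apply: leq_trans le_bin; have := card_draws 'I_n (k - #|D|); rewrite card_ord => <-.
apply/subset_leq_card/subsetP => A /imsetP[F].
by rewrite !inE => /andP[/eqP <- sDF] ->; rewrite cardsD (setIidPr sDF).
Qed.

Lemma card_leq_sum_codegree {n} (G : {set {set 'I_n}}) (W : {set 'I_n}) :
  {in G, forall F : {set 'I_n}, ~~ [disjoint F & W]} ->
  #|G| <= \sum_(w in W) codegree G [set w].
Proof.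
move=> meet; under [leqRHS]eq_bigr do rewrite /codegree -sum1_card.
rewrite (exchange_big_dep (mem G)) /=; last by move=> w F _; rewrite inE => /andP[].
rewrite -sum1_card; apply: leq_sum => F FG.
have /pred0Pn[w /andP[wF wW]] := meet _ FG.
rewrite (bigD1 w) //=; apply/andP; split=> //.
by rewrite inE sub1set; apply/andP.
Qed.

(** An edge through [v] that meets [W] contains a pair [[set v; w]] with [w] in [W], and each pair
    lies in at most [n ^ m] edges. *)
Lemma exists_edge_avoiding {n m} (H : {set {set 'I_n}}) (v : 'I_n) (W : {set 'I_n}) :
  H \subset ksubsets n m.+2 -> v \notin W ->
  #|W| * n ^ m < codegree H [set v] ->
  exists2 F, F \in H & (v \in F) && [disjoint F & W].
Proof.
move=> /subsetP HK vW; rewrite ltnNge => big.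
apply/exists_inP; apply: contraNT big; rewrite negb_exists_in => /forall_inP meet.
apply: leq_trans (card_leq_sum_codegree _ W _) _ => [F|].
  by rewrite inE sub1set => /andP[/meet]; rewrite negb_and; case: (v \in F).
rewrite -sum_nat_const; apply: leq_sum => w wW.
apply: leq_trans (_ : #|[set F in ksubsets n m.+2 | [set v; w] \subset F]| <= _).
  apply/subset_leq_card/subsetP => F; rewrite !inE subUset.
  by rewrite -andbA => /and3P[/HK + -> ->]; rewrite inE => ->.
apply: leq_trans (card_ksubsets_supset _) _.
rewrite cards2; case: eqP vW => [-> | _ _]; first by rewrite wW.
by rewrite subn2.
Qed.

(** * Building matchings greedily *)

Lemma matchingU1 {n} (H M : {set {set 'I_n}}) (F : {set 'I_n}) :
  is_matching H M -> F \in H -> [disjoint F & cover M] -> is_matching H (F |: M).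
Proof.
case/andP=> MH /forall_inP disM FH disF; apply/andP; split.
  by rewrite subUset sub1set FH.
have disFA A : A \in M -> [disjoint F & A].
  by move=> AM; apply: disjointWr disF; apply: bigcup_sup.
apply/forall_inP => A; rewrite !inE => /orP[/eqP-> | AM]; apply/forall_inP => B;
  rewrite !inE => /orP[/eqP-> | BM].
- by rewrite eqxx.
- by rewrite disFA // implybT.
- by rewrite disjoint_sym disFA // implybT.
- exact: (forall_inP (disM _ AM)).
Qed.

Lemma card_cover_matching {n k} (H M : {set {set 'I_n}}) :
  H \subset ksubsets n k -> is_matching H M -> #|cover M| <= k * #|M|.
Proof.
move=> /subsetP HK /andP[/subsetP MH _]; rewrite (leq_trans (leq_card_cover M)) //.
rewrite mulnC -sum_nat_const; apply: leq_sum => F /MH/HK.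
by rewrite inE => /eqP->.
Qed.

Lemma leq_matching_number {n} (H M : {set {set 'I_n}}) :
  is_matching H M -> #|M| <= matching_number H.
Proof. exact: (@leq_bigmax_cond _ (is_matching H) (fun M => #|M|)). Qed.

(** Induction on [#|S|]: each step spends one vertex of [S] on an edge that avoids the current
    matching and the rest of [S]. The bound [s.+1] suffices to contradict a matching number of at
    most [s]. *)
Lemma extend_matching {n m s} (H M : {set {set 'I_n}}) (S : {set 'I_n}) :
  H \subset ksubsets n m.+2 -> is_matching H M -> [disjoint cover M & S] ->
  {in S, forall v, m.+2 * s * n ^ m < codegree H [set v]} ->
  #|M| + #|S| <= s.+1 -> #|M| + #|S| <= matching_number H.
Proof.
move=> HK; move eq_t: #|S| => t.
elim: t => [|t IHt] in M S eq_t *; first by rewrite addn0 => /leq_matching_number.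
move=> matM disMS bigS le_s.
have /card_gt0P[v vS] : 0 < #|S| by rewrite eq_t.
have cS : #|S :\ v| = t by move: eq_t; rewrite (cardsD1 v) vS => -[].
have vM : v \notin cover M by rewrite (disjointFl disMS).
have [||F FH /andP[vF]] := exists_edge_avoiding _ v (cover M :|: S :\ v) HK.
- by rewrite !inE eqxx orbF.
(* With [v] removed, [#|M| + t <= s], so the vertices to avoid number at most
   [m.+2 * #|M| + t <= m.+2 * s]; this is the source of the degree threshold. *)
- apply: leq_ltn_trans (bigS _ vS); rewrite leq_mul2r; apply/orP; right.
  rewrite (leq_trans (leq_card_setU _ _)) // cS.
  by have := card_cover_matching _ _ HK matM; nia.
rewrite disjoints_subset setCU subsetI -!disjoints_subset => /andP[disFM disFS].
have FnM : F \notin M.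
  by apply: contra vM => FM; apply/bigcupP; exists F.
have := IHt (F |: M) (S :\ v) cS (matchingU1 _ _ _ matM FH disFM).
rewrite cardsU1 FnM add1n addSnnS; apply => //.
- rewrite disjoints_subset /cover bigcup_setU big_set1 subUset -!disjoints_subset disFS.
  by apply: disjointWr disMS; apply: subsetDl.
- by move=> w; rewrite inE => /andP[_ /bigS].
Qed.

(** * Edges that avoid the vertices of large degree *)

Definition residual {n} (H : {set {set 'I_n}}) (S : {set 'I_n}) : {set {set 'I_n}} :=
  [set F in H | [disjoint F & S]].

Lemma residual_sub {n} (H : {set {set 'I_n}}) (S : {set 'I_n}) : residual H S \subset H.
Proof. by apply/subsetP => F; rewrite inE => /andP[]. Qed.

(* The edges of the residual all meet the cover of a maximal matching in it. *)
Lemma card_residual {n k B} (H : {set {set 'I_n}}) (S : {set 'I_n}) :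
  0 < k -> H \subset ksubsets n k ->
  (forall v, v \notin S -> codegree H [set v] <= B) ->
  #|residual H S| <= k * matching_number H * B.
Proof.
move=> k_gt0 HK smallH; set R := residual H S.
have RH : R \subset H := residual_sub H S.
have [|M /maxsetP[matM maxM]] := @ex_maxset _ (is_matching R).
  exists set0; rewrite /is_matching sub0set; apply/forall_inP => A.
  by rewrite inE.
have /andP[MR disM] := matM.
have matHM : is_matching H M by rewrite /is_matching (subset_trans MR RH).
apply: leq_trans (card_leq_sum_codegree _ (cover M) _) _ => [F FR|].
  (* Maximality puts [F] in [M], so [F] is disjoint from a cover containing it and must be empty,
     against [0 < k]. *)
  apply/negP => disF; have /setP/(_ F) := maxM _ (matchingU1 _ _ _ matM FR disF) (subsetUr _ _).
  rewrite setU11 => /esym FM.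
  have F0 : F = set0.
    apply/eqP; rewrite -subset0 -(setICr F) subsetI subxx -disjoints_subset.
    by apply: disjointWr disF; apply: bigcup_sup.
  have := subsetP HK _ (subsetP RH _ FR); rewrite inE F0 cards0 => /eqP k0.
  by rewrite -k0 in k_gt0.
apply: leq_trans (_ : #|cover M| * B <= _).
  rewrite -sum_nat_const; apply: leq_sum => w /bigcupP[A AM wA].
  apply: leq_trans (codegreeS _ _ _ RH) (smallH _ _).
  have := subsetP MR _ AM; rewrite inE => /andP[_ disA].
  by rewrite (disjointFr disA wA).
rewrite leq_mul2r (leq_trans (card_cover_matching _ _ HK matHM)) ?orbT //.
by rewrite leq_mul2l leq_matching_number ?orbT.
Qed.

(** * Comparing the norm of a family with that of a star *)

Lemma sum_codegree {n k} (H : {set {set 'I_n}}) :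
  H \subset ksubsets n k.+1 ->
  \sum_(E in ksubsets n k) codegree H E = k.+1 * #|H|.
Proof.
move=> /subsetP HK; under eq_bigr do rewrite /codegree -sum1_card.
rewrite (exchange_big_dep (mem H)) /=; last by move=> E F _; rewrite inE => /andP[].
rewrite mulnC -sum_nat_const; apply: eq_bigr => F FH.
have := HK _ FH; rewrite inE => /eqP cF.
rewrite sum1dep_card -(binSn k) -cF -cards_draws.
by apply: eq_card => E; rewrite !inE FH andbC.
Qed.

(** A vertex completing [E] to an edge either lies in [S] or, since [E] misses [S], yields an edge
    of the residual. *)
Lemma codegree_residual {n k} (H : {set {set 'I_n}}) (S E : {set 'I_n}) :
  H \subset ksubsets n k.+1 -> #|E| = k -> E :&: S = set0 ->
  codegree H E <= #|S| + codegree (residual H S) E.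
Proof.
move=> HK cE ES; rewrite (codegreeE _ _ HK cE).
rewrite (codegreeE _ _ (subset_trans (residual_sub H S) HK) cE).
apply: leq_trans (leq_card_setU _ _); apply/subset_leq_card/subsetP => v.
rewrite !inE => /andP[-> ->] /=; case: (boolP (v \in S)) => //= vS.
by rewrite -setI_eq0 setIUl ES setU0 setI_eq0 disjoints1.
Qed.

Lemma codegree_star_meet {n k} (T E : {set 'I_n}) :
  #|E| = k -> E :&: T != set0 -> codegree (star k.+1 T) E = n - k.
Proof.
move=> cE mE; rewrite (codegreeE _ _ (star_sub _ _) cE).
have -> : n - k = #|~: E| by have := cardsC E; rewrite card_ord; lia.
apply: eq_card => v; rewrite !inE; case: (boolP (v \in E)) => //= vE.
rewrite cardsU1 vE cE add1n eqxx; apply: contraNneq mE => /eqP.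
by rewrite setIUl setU_eq0 => /andP[_].
Qed.

Lemma codegree_star_avoid {n k} (T E : {set 'I_n}) :
  #|E| = k -> E :&: T = set0 -> codegree (star k.+1 T) E = #|T|.
Proof.
move=> cE ET; rewrite (codegreeE _ _ (star_sub _ _) cE).
apply: eq_card => v; rewrite !inE setIUl ET setU0.
have -> : ([set v] :&: T != set0) = (v \in T) by rewrite setI_eq0 disjoints1 negbK.
case: (boolP (v \in T)) => vT; last by rewrite !andbF.
have vE : v \notin E.
  by apply/negP => vE; have := in_set0 v; rewrite -ET inE vE vT.
by rewrite cardsU1 vE cE eqxx.
Qed.

(** For [d > 0] this combines [t + d <= t.+1 * d] with [d ^ p <= n ^ p.-1 * d]. The error is linear
    in [d], so that it can be summed by double counting. *)
Lemma expnD_leq t d n p : 0 < p -> d <= n ->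
  (t + d) ^ p <= t ^ p + t.+1 ^ p * n ^ p.-1 * d.
Proof.
case: p d => // p [|d] _ le_dn; first by rewrite addn0 leq_addr.
apply: leq_trans (leq_addl _ _); apply: leq_trans (_ : (t.+1 * d.+1) ^ p.+1 <= _).
  by rewrite leq_exp2r //; nia.
rewrite expnMn -mulnA leq_mul2l [d.+1 ^ _]expnSr leq_mul2r; apply/orP; right.
by case: p => // p; rewrite leq_exp2r ?orbT.
Qed.

(** The comparison is made term by term in [E], with gain and error written additively on opposite
    sides. *)
Lemma co_norm_residual {n k p} (H : {set {set 'I_n}}) (S T : {set 'I_n}) :
  0 < p -> H \subset ksubsets n k.+1 -> S \subset T -> #|T| <= n - k ->
  co_norm k.+1 p H
    + #|[set E in ksubsets n k | (E :&: S == set0) && (E :&: T != set0)]|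
      * ((n - k) ^ p - #|T| ^ p)
  <= co_norm k.+1 p (star k.+1 T)
    + #|T|.+1 ^ p * n ^ p.-1 * (k.+1 * #|residual H S|).
Proof.
move=> p_gt0 HK ST leT; rewrite /co_norm /=.
rewrite -(sum_codegree _ (subset_trans (residual_sub H S) HK)) big_distrr /=.
rewrite -sum_nat_const (eq_bigl (fun E => (E \in ksubsets n k) &&
  ((E :&: S == set0) && (E :&: T != set0)))); last by move=> E; rewrite inE.
rewrite big_mkcondr -!big_split /=; apply: leq_sum => E; rewrite inE => /eqP cE.
have leST := subset_leq_card ST.
have exp_homo a b : a <= b -> a ^ p <= b ^ p by rewrite leq_exp2r.
have leH := codegree_leq _ _ HK cE.
(* If [E] meets [S] it meets [T], and its codegree in the star is the largest possible, [n - k]. *)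
case: (eqVneq (E :&: S) set0) => [ES | mES] /=; last first.
  rewrite codegree_star_meet //; first by rewrite addn0 (leq_trans (exp_homo _ _ leH)) ?leq_addr.
  by apply: contraNneq mES => ET; rewrite -subset0 -ET setIS.
set R := residual H S; set d := codegree R E.
have le_d : d <= n.
  by have := codegree_leq _ _ (subset_trans (residual_sub H S) HK) cE; rewrite -/R -/d; lia.
have le_co : codegree H E ^ p <= #|T| ^ p + #|T|.+1 ^ p * n ^ p.-1 * d.
  apply: leq_trans (exp_homo _ _ (codegree_residual _ _ _ HK cE ES)) _.
  by apply: leq_trans (expnD_leq _ _ _ _ p_gt0 le_d); apply: exp_homo; rewrite leq_add2r.
case: (eqVneq (E :&: T) set0) => [ET | mET] /=.
  by rewrite addn0 codegree_star_avoid.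
(* Here the star gains; [#|T| <= n - k] keeps the truncated difference of powers exact. *)
rewrite codegree_star_meet //; apply: leq_trans (leq_add le_co (leqnn _)) _.
by rewrite addnAC leq_add2r subnKC // exp_homo.
Qed.

(** * Size of the gain when [n] is large *)

Lemma card_meet_avoid {n m} (S T : {set 'I_n}) : S \proper T ->
  'C(n - #|T|, m) <=
    #|[set E in ksubsets n m.+1 | (E :&: S == set0) && (E :&: T != set0)]|.
Proof.
(* With [x] in [T] but not in [S], the sets [x |: A] for [A] disjoint from [T] are distinct and all
   counted. *)
case/properP=> /subsetP ST [x xT xS].
have -> : n - #|T| = #|~: T| by have := cardsC T; rewrite card_ord; lia.
have xA (A : {set 'I_n}) : A \subset ~: T -> x \notin A.
  by move=> /subsetP AT; apply/negP => /AT; rewrite inE xT.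
have inj : {in [set A : {set 'I_n} | A \subset ~: T & #|A| == m] &, injective (fun A : {set 'I_n} => x |: A)}.
  move=> A B; rewrite !inE => /andP[/xA nA _] /andP[/xA nB _] eqAB.
  by rewrite -(setU1K nA) eqAB setU1K.
rewrite -cards_draws -(card_in_imset inj).
apply/subset_leq_card/subsetP => _ /imsetP[A + ->]; rewrite !inE => /andP[AT /eqP cA].
rewrite cardsU1 xA // cA eqxx /=; apply/andP; split.
  rewrite setI_eq0; apply/pred0P => y /=; rewrite !inE.
  case: eqP => [-> | _]; first by rewrite (negPf xS).
  by apply/negP => /andP[/(subsetP AT)]; rewrite inE => /negP nyT /ST.
by apply/set0Pn; exists x; rewrite !inE eqxx.
Qed.

Lemma expn_leq_ffact N m : (N - m) ^ m <= N ^_ m.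
Proof.
suff H j : j <= m -> (N - m) ^ j <= N ^_ j by apply: H.
elim: j => // j IHj ltjm; rewrite ffactnSr expnSr leq_mul ?IHj //; lia.
Qed.

Lemma expn_leq_double a b e : a <= 2 * b -> a ^ e <= 2 ^ e * b ^ e.
Proof. by case: e => // e leab; rewrite -expnMn leq_exp2r. Qed.

(** The three summands of the threshold have separate uses: the first makes [n - s - m] and
    [n - m.+1] at least half of [n], the second then makes [n - m.+1] at least [2 * s], and the
    third beats [L] times the constants lost on the way. *)
Lemma growth_bound n m p s L :
  0 < p -> 2 * (s + m.+1) + 4 * s + 2 ^ (m + p.+1) * m`! * L < n ->
  n ^ p.-1 * (L * n ^ m) < 'C(n - s, m) * ((n - m.+1) ^ p - s ^ p).
Proof.
move=> p_gt0 le_n; set C := 'C(_, _).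
have hC : n ^ m <= 2 ^ m * (C * m`!).
  rewrite bin_ffact; apply: leq_trans (expn_leq_double _ (n - s - m) m _) _; first lia.
  by rewrite leq_mul2l expn_leq_ffact orbT.
have hD : n ^ p <= 2 ^ p * (n - m.+1) ^ p by apply: expn_leq_double; lia.
have hS : 2 * s ^ p <= (n - m.+1) ^ p.
  apply: leq_trans (_ : (2 * s) ^ p <= _); last by rewrite leq_exp2r //; lia.
  by rewrite expnMn leq_mul2r -{1}(expn1 2) leq_exp2l // p_gt0 orbT.
set D := (n - m.+1) ^ p - s ^ p.
(* By [hS], subtracting [s ^ p] costs at most half, hence the extra factor 2. *)
have hD' : n ^ p <= 2 ^ p.+1 * D by rewrite expnS /D; nia.
have := leq_mul hC hD'.
have -> : n ^ p = n * n ^ p.-1 by rewrite -expnS prednK.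
rewrite addnS -addSn addnC expnD in le_n.
have X_gt0 : 0 < n ^ m by rewrite expn_gt0; lia.
have Y_gt0 : 0 < n ^ p.-1 by rewrite expn_gt0; lia.
move: X_gt0 Y_gt0 le_n; clearbody C D.
move: (n ^ m) (n ^ p.-1) (2 ^ m) (2 ^ p.+1) (m`!) => X Y A B f X_gt0 Y_gt0 le_n hXY.
rewrite ltnNge; apply/negP => le_CD; move: hXY; apply/negP; rewrite -ltnNge.
have -> : A * (C * f) * (B * D) = A * B * f * (C * D) by ring.
apply: leq_ltn_trans (_ : A * B * f * (Y * (L * X)) < _); first by rewrite leq_mul2l le_CD orbT.
have -> : A * B * f * (Y * (L * X)) = B * A * f * L * (X * Y) by ring.
have -> : X * (n * Y) = n * (X * Y) by ring.
by rewrite ltn_pmul2r ?muln_gt0 ?X_gt0 //; lia.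
Qed.

(** * The dichotomy between stars and strictly smaller norm *)

Lemma exists_subset_card {T : finType} (B : {set T}) j :
  j <= #|B| -> exists2 A : {set T}, A \subset B & #|A| = j.
Proof.
rewrite -bin_gt0 -cards_draws => /card_gt0P[A].
by rewrite inE => /andP[sAB /eqP cA]; exists A.
Qed.

Lemma exists_superset_card {n s} (S : {set 'I_n}) :
  #|S| <= s -> s <= n -> exists2 T : {set 'I_n}, S \subset T & #|T| = s.
Proof.
move=> leSs lesn; have cC : #|~: S| = n - #|S| by have := cardsC S; rewrite card_ord; lia.
have [|A AS cA] := @exists_subset_card _ (~: S) (s - #|S|); first by lia.
exists (S :|: A); first exact: subsetUl.
have disSA : [disjoint S & A] by rewrite disjoint_sym disjoints_subset.
by move/eqP: (eq_leqif (leq_card_setU S A)); rewrite disSA; lia.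
Qed.

Lemma uniform1_star {n s} (H : {set {set 'I_n}}) :
  H \subset ksubsets n 1 -> matching_number H <= s -> s <= n ->
  exists2 T : {set 'I_n}, #|T| = s & H \subset star 1 T.
Proof.
move=> HK nuH lesn; have matH : is_matching H H.
  rewrite /is_matching subxx; apply/forall_inP => A AH; apply/forall_inP => B BH.
  have := subsetP HK _ AH; rewrite inE => /cards1P[x ->].
  have := subsetP HK _ BH; rewrite inE => /cards1P[y ->].
  by apply/implyP => neq; rewrite disjoints1 inE; apply: contraNneq neq => ->.
have [|T HT cT] := @exists_superset_card n s (cover H) _ lesn.
  apply: leq_trans (card_cover_matching _ _ HK matH) _.
  by rewrite mul1n (leq_trans (leq_matching_number _ _ matH)).
exists T => //; apply/subsetP => F FH; rewrite inE (subsetP HK _ FH) /=.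
have := subsetP HK _ FH; rewrite inE => /cards1P[x Fx].
apply/set0Pn; exists x; rewrite inE Fx set11; apply: (subsetP HT).
by apply/bigcupP; exists F; rewrite // Fx set11.
Qed.

Lemma star_or_small {n m s p} (H : {set {set 'I_n}}) :
  0 < p -> H \subset ksubsets n m.+2 -> matching_number H <= s ->
  2 * (s + m.+1) + 4 * s
    + 2 ^ (m + p.+1) * m`! * (s.+1 ^ p * m.+2 * (m.+2 * s * (m.+2 * s))) < n ->
  (exists2 T : {set 'I_n}, #|T| = s & H \subset star m.+2 T) \/
  (exists2 T : {set 'I_n}, #|T| = s & co_norm m.+2 p H < co_norm m.+2 p (star m.+2 T)).
Proof.
move=> p_gt0 HK nuH large_n.
pose S := [set v | m.+2 * s * n ^ m < codegree H [set v]].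
have bigS : {in S, forall v, m.+2 * s * n ^ m < codegree H [set v]}.
  by move=> v; rewrite inE.
have mat0 : is_matching H set0.
  by rewrite /is_matching sub0set; apply/forall_inP => A; rewrite inE.
have leSs : #|S| <= s.
  (* Otherwise [s.+1] vertices of [S] extend the empty matching to one of size [s.+1]. *)
  rewrite leqNgt; apply/negP => /exists_subset_card[S' S'S cS'].
  have := @extend_matching n m s H set0 S' HK mat0.
  rewrite cards0 cS' /cover big_set0 disjoints_subset sub0set.
  move=> /(_ isT (sub_in1 (subsetP S'S) bigS) (leqnn _)).
  by rewrite leqNgt ltnS nuH.
have [T ST cT] : exists2 T : {set 'I_n}, S \subset T & #|T| = s.
  by apply: exists_superset_card => //; lia.
have [eqSs | ltSs] := eqVneq #|S| s.
  left; exists T => //; have <- : S = T by apply/eqP; rewrite eqEcard ST cT eqSs /=.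
  apply/subsetP => F FH; rewrite inE (subsetP HK _ FH) /=.
  apply/negP => /eqP FS.
  (* An edge [F] missing [S] would serve as a starting matching, extended by the [s] vertices of [S]
     to size [s.+1]. *)
  have mat1 : is_matching H [set F].
    rewrite -(setU0 [set F]); apply: matchingU1 => //.
    by rewrite /cover big_set0 disjoint_sym disjoints_subset sub0set.
  have := @extend_matching n m s H [set F] S HK mat1.
  rewrite cover1 -setI_eq0 FS eqxx cards1 eqSs add1n => /(_ isT bigS (leqnn _)).
  by rewrite leqNgt ltnS nuH.
right; exists T => //.
have propST : S \proper T by rewrite properEcard ST cT ltn_neqAle ltSs.
have cR : #|residual H S| <= m.+2 * s * (m.+2 * s * n ^ m).
  apply: leq_trans (card_residual H S _ HK _) _; first by [].
    by move=> v; rewrite inE -leqNgt; apply.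
  by rewrite leq_mul2r leq_mul2l nuH !orbT.
have leTn : #|T| <= n - m.+1 by lia.
have := @co_norm_residual n m.+1 p H S T p_gt0 HK ST leTn.
have := card_meet_avoid (m := m) S T propST; rewrite cT.
have := growth_bound _ _ _ _ _ p_gt0 large_n.
set N := #|[set E in _ | _]|; set C := 'C(_, _); set D := _ - s ^ p.
move=> lt_CD le_CN le_co; rewrite -(ltn_add2r (N * D)).
apply: leq_ltn_trans le_co _; rewrite ltn_add2l.
apply: leq_trans (leq_mul le_CN (leqnn D)); apply: leq_ltn_trans lt_CD.
(* The constant [L] collects [s.+1 ^ p] from the power estimate, [m.+2] from double counting, and
   two factors [m.+2 * s] from the cover size and the degree threshold. *)
apply: leq_trans (_ : s.+1 ^ p * n ^ p.-1 * (m.+2 * (m.+2 * s * (m.+2 * s * n ^ m))) <= _).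
  by rewrite !leq_mul2l cR !orbT.
by apply/eq_leq; ring.
Qed.

Theorem theorem1p8 (k s p : nat) (hk : 1 <= k) (hs : 1 <= s) (hp : 1 <= p) :
  exists n0 : nat, forall n : nat, n0 <= n ->
    forall H : {set {set 'I_n}},
      H \subset ksubsets n k ->
      matching_number H <= s ->
      co_norm k p H <= co_norm k p (Hnks n k s) /\
      (co_norm k p H = co_norm k p (Hnks n k s) <-> family_iso H (Hnks n k s)).
Proof.
case: k hk => [|[|m]] // _.
  exists s => n lesn H HK nuH; have [T <- HT] := uniform1_star H HK nuH lesn.
  exact: theorem_star.
(* The value of [n0] is fixed by unification with the size hypothesis of [star_or_small]. *)
eexists => n large_n H HK nuH.
have [[T <- HT] | [T <-]] := star_or_small H hp HK nuH large_n.
  exact: theorem_star.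
rewrite (family_iso_co_norm _ _ _ _ (star_iso _ T)) => lt_co.
split; first exact: ltnW.
(* Equality contradicts the strict bound; the converse is invariance of the norm. *)
split=> [eq_co | /family_iso_co_norm eq_co]; first by rewrite eq_co ltnn in lt_co.
exact: eq_co.
Qed.
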